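(* Suppose that $\mathrm{zer}(\Phi)\neq\emptyset$, $F$ is $L$-Lipschitz continuous, and $\Phi$ is $\rho$-co-hypomonotone with $2L\rho<1$. Let $r>2$, and let $\beta,\eta$ satisfy $2\rho<\beta<\eta<\frac1L$. Put $\hat\phi:=\frac{1-L^2\eta^2}{2L^2\eta^2}>0$, $\omega:=\frac{\eta-\beta}2>0$, and $t_k:=k+t_0$, where $t_0$ is the constant defined in the context. Let $\{(x^k,y^k)\}$ be generated by the scheme (AEG) described in the context with these parameters. Then $$\lim_{k\to\infty}k^2\|Fx^k+\xi^k\|^2=0,\qquad\lim_{k\to\infty}k^2\|x^{k+1}-x^k\|^2=0,\qquad\lim_{k\to\infty}k^2\|y^k-x^k\|^2=0.$$ That is, $\|Fx^k+\xi^k\|=o(1/k)$, $\|x^{k+1}-x^k\|=o(1/k)$, and $\|y^k-x^k\|=o(1/k)$.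
   Context: $\mathbb R^p$ carries the standard inner product and Euclidean norm. $F:\mathbb R^p\to\mathbb R^p$ is single-valued, $T:\mathbb R^p\rightrightarrows2^{\mathbb R^p}$ is set-valued, $\Phi:=F+T$, $\mathrm{zer}(\Phi)=\{x:0\in Fx+Tx\}$. For $\rho\ge0$, $\Phi$ is $\rho$-co-hypomonotone if $\langle u-v,x-y\rangle\ge-\rho\|u-v\|^2$ for all $(x,u),(y,v)\in\mathrm{gra}(\Phi)$. $F$ is $L$-Lipschitz continuous if $\|Fx-Fy\|\le L\|x-y\|$ for all $x,y$. The resolvent $J_{\eta T}$, $J_{\eta T}x=\{y:x\in y+\eta Ty\}$, is assumed to be defined on all of $\mathbb R^p$ and single-valued. Scheme (AEG): start from $x^0\in\mathrm{dom}(\Phi)$, $\xi^0\in Tx^0$, $y^{-1}=y^0:=x^0$. With $\xi^k\in Tx^k$ put $w^k:=Fx^k+\xi^k$ and $\hat w^k:=Fy^{k-1}+\xi^k$. For $k\ge0$: $$d^k:=\hat w^{k+1}-\gamma_kw^k,\qquad x^{k+1}:=y^k-\eta d^k,\qquad y^{k+1}:=x^{k+1}+\theta_k(x^{k+1}-x^k)-\eta_kw^{k+1}+\lambda_k\hat w^{k+1}-\nu_kw^k,$$ where the implicit definition of $x^{k+1}$ means $x^{k+1}=J_{\eta T}(y^k-\eta Fy^k+\eta\gamma_kw^k)$ and $\xi^{k+1}:=\frac1\eta(y^k-\eta Fy^k+\eta\gamma_kw^k-x^{k+1})\in Tx^{k+1}$. Parameters (the general parameter $\mu$ of the paper is set to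 $\mu:=1$): $t_{k+1}=t_k+1$ and $$\theta_k:=\frac{t_k-r-1}{t_{k+1}},\quad\gamma_k:=\frac{t_k-r+1}{t_k},\quad\eta_k:=\frac{(\eta-\beta)t_k-\delta}{t_{k+1}},\quad\lambda_k:=\frac{\eta t_k}{t_{k+1}},\quad\nu_k:=\frac{\beta t_k}{t_{k+1}},\quad\delta:=(r-1)\beta+\frac{(r-2)(\eta-\beta)}2.$$ Constants (with $\mu=1$): $$\Gamma:=\frac{(r-2)^2\eta^2+(4r-6)\eta\beta-(r^2-2)\beta^2}{4},\qquad\hat\Gamma:=\frac{2\Gamma}{r-2}+4\rho\omega r,$$ $$t_0:=\max\Big\{\frac{r+1}2+\frac{\eta}{2\hat\phi\omega},\ \frac{\hat\Gamma}{(\eta-\beta)^2},\ \frac{4\rho[\eta-\omega(r+1)]}{\omega(\beta-2\rho)},\ \frac{\eta(r-1)}{\eta-\beta}\Big\}.$$ *)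

(* Defs.v *)
From HB Require Import structures.
From mathcomp Require Import all_boot all_order all_algebra.
From mathcomp Require Import all_classical all_reals all_analysis.

Set Implicit Arguments.
Unset Strict Implicit.
Unset Printing Implicit Defensive.

Import Order.TTheory GRing.Theory Num.Theory.
Import numFieldNormedType.Exports.

Local Open Scope classical_set_scope.
Local Open Scope ring_scope.

Section Euclidean.
Context {R : realType} {p : nat}.

Definition dotp (u v : 'rV[R]_p) : R := \sum_(i < p) u 0 i * v 0 i.

(* The library norm `|u| on 'rV[R]_p is the sup norm, so the Euclidean norm and
   Lipschitz continuity with respect to it are defined here. *)
Definition enorm (u : 'rV[R]_p) : R := Num.sqrt (dotp u u).

Definition elipschitz (L : R) (F : 'rV[R]_p -> 'rV[R]_p) : Prop :=
  forall x y, enorm (F x - F y) <= L * enorm (x - y).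

End Euclidean.

(* A set-valued operator on R^p is a function 'rV[R]_p -> set 'rV[R]_p. *)
Section Operators.
Context {R : realType} {p : nat}.
Implicit Types (F : 'rV[R]_p -> 'rV[R]_p) (T Phi : 'rV[R]_p -> set 'rV[R]_p).

Definition op_sum F T : 'rV[R]_p -> set 'rV[R]_p :=
  fun x => [set F x + xi | xi in T x].

Definition gra Phi : set ('rV[R]_p * 'rV[R]_p) := [set xu | Phi xu.1 xu.2].

Definition dom Phi : set 'rV[R]_p := [set x | Phi x !=set0].

Definition zer Phi : set 'rV[R]_p := [set x | Phi x 0].

Definition cohypomonotone (rho : R) Phi : Prop :=
  forall x u y v, gra Phi (x, u) -> gra Phi (y, v) ->
    dotp (u - v) (x - y) >= - rho * enorm (u - v) ^+ 2.

Definition resolvent (eta : R) T : 'rV[R]_p -> set 'rV[R]_p :=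
  fun x => [set y | exists2 xi, T y xi & x = y + eta *: xi].

End Operators.

Section Constants.
Context {R : realType}.
Implicit Types L rho r beta eta : R.

Definition phi_hat L eta : R :=
  (1 - L ^+ 2 * eta ^+ 2) / (2 * L ^+ 2 * eta ^+ 2).

Definition omega beta eta : R := (eta - beta) / 2.

Definition Gamma r beta eta : R :=
  ((r - 2) ^+ 2 * eta ^+ 2 + (4 * r - 6) * eta * beta
   - (r ^+ 2 - 2) * beta ^+ 2) / 4.

Definition Gamma_hat rho r beta eta : R :=
  2 * Gamma r beta eta / (r - 2) + 4 * rho * omega beta eta * r.

Definition t_zero L rho r beta eta : R :=
  let om := omega beta eta in
  Num.max ((r + 1) / 2 + eta / (2 * phi_hat L eta * om))
  (Num.max (Gamma_hat rho r beta eta / (eta - beta) ^+ 2)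
  (Num.max (4 * rho * (eta - om * (r + 1)) / (om * (beta - 2 * rho)))
           (eta * (r - 1) / (eta - beta)))).

Definition t_seq L rho r beta eta (k : nat) : R :=
  k%:R + t_zero L rho r beta eta.

Definition delta r beta eta : R :=
  (r - 1) * beta + (r - 2) * (eta - beta) / 2.

Definition theta_ r (t : nat -> R) (k : nat) : R := (t k - r - 1) / t k.+1.

Definition gamma_ r (t : nat -> R) (k : nat) : R := (t k - r + 1) / t k.

Definition eta_ r beta eta (t : nat -> R) (k : nat) : R :=
  ((eta - beta) * t k - delta r beta eta) / t k.+1.

Definition lambda_ eta (t : nat -> R) (k : nat) : R := eta * t k / t k.+1.

Definition nu_ beta (t : nat -> R) (k : nat) : R := beta * t k / t k.+1.

End Constants.

Section Scheme.
Context {R : realType} {p : nat}.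
Variables (F : 'rV[R]_p -> 'rV[R]_p) (T : 'rV[R]_p -> set 'rV[R]_p).
Variables (r beta eta : R) (t : nat -> R) (x y xi : nat -> 'rV[R]_p).

Definition w_seq (k : nat) : 'rV[R]_p := F (x k) + xi k.

(* Since 0.-1 = 0 in nat, y k.-1 implements the convention y^{-1} = y^0. *)
Definition what_seq (k : nat) : 'rV[R]_p := F (y k.-1) + xi k.

Definition d_seq (k : nat) : 'rV[R]_p :=
  what_seq k.+1 - gamma_ r t k *: w_seq k.

Definition forward_point (k : nat) : 'rV[R]_p :=
  y k - eta *: F (y k) + (eta * gamma_ r t k) *: w_seq k.

(* The update x^{k+1} = y^k - eta d^k is implicit (d^k involves xi^{k+1});
   AEG_resolvent and AEG_xi give its meaning, and AEG_x, a rearrangement of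
   AEG_xi when eta != 0, records the update itself. *)
Record AEG : Prop := {
  AEG_x0 : dom (op_sum F T) (x 0%N) ;
  AEG_xi0 : T (x 0%N) (xi 0%N) ;
  AEG_y0 : y 0%N = x 0%N ;
  AEG_resolvent : forall k, resolvent eta T (forward_point k) = [set x k.+1] ;
  AEG_xi : forall k, xi k.+1 = eta^-1 *: (forward_point k - x k.+1) ;
  AEG_x : forall k, x k.+1 = y k - eta *: d_seq k ;
  AEG_y : forall k,
    y k.+1 = x k.+1 + theta_ r t k *: (x k.+1 - x k)
             - eta_ r beta eta t k *: w_seq k.+1
             + lambda_ eta t k *: what_seq k.+1
             - nu_ beta t k *: w_seq k }.

End Scheme.

(* Main.v *)
Require Import Defs.
From HB Require Import structures.
From mathcomp Require Import all_boot all_order all_algebra.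
From mathcomp Require Import all_classical all_reals all_analysis.
From mathcomp Require Import ring lra.

(** With w^k = F x^k + xi^k, om = (eta - beta) / 2 and
      z^k = t_k (y^k - x^k) + (om t_k - (r - 1) (om + beta)) w^k,
    the forward evaluations F y^k drop out of the update of z:
      z^(k+1) - z^k = - (r + 1) X - om (r - 1) w - om t_k D,
    where X = x^(k+1) - x^k, D = w^(k+1) - w^k, w = w^k ([momentum_step]).  As z
    is t x' + om t w to leading order, this discretizes
      t x'' + (r + 2) x' + 2 om t w' + om r w = 0.
    The implicit step expresses z^k through X, D, w and the error
    e = what^(k+1) - w^(k+1) = F y^k - F x^(k+1) ([momentum_expansion]).

    For a zero xs of Phi and u = x - xs, consider for a parameter c
      E_c = |c u + z|^2 + c (r + 1 - c) |u|^2 + 2 c om (t - 1) <w, u>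
            + om^2 (t - 1)^2 |w|^2.
    Its increment is an explicit quadratic form ([energy_increment]) in which
    the products of u with X and with D cancel.  Three inequalities control it:
    co-hypomonotonicity bounds <D, X> and <w, u> from below, and the Lipschitz
    bound |e| <= L eta |d|, with d = what^(k+1) - gamma_k w^k, bounds the
    product of e with D and w.  The t^2 part is then at most
      - om t^2 (beta - 2 rho) |D|^2 - 2 phi_hat om eta t^2 |e|^2,
    negative because beta > 2 rho and L eta < 1.  Write
    b = t (|X|^2 + |w|^2) + t^2 (|D|^2 + |e|^2).  Once t is large:
    - for c = r the term t <X, w> disappears as well, and E_r, which is
      nonnegative, decreases by at least a multiple of b ([energy_descent]);
    - for c = 0 the distance to xs disappears, E_0 increases by at most a
      multiple of b ([potential_growth]), and E_0 is at most a multiple of t b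
      ([potential_le]).
    Consequently E_0 converges, and its limit is 0: otherwise b would dominate
    a multiple of 1 / k, whose sum diverges, while the sum of b is bounded by
    the initial E_r ([lyapunov_vanish]).  Finally E_0 + b controls t^2 |w|^2,
    t^2 |X|^2 and t^2 |y - x|^2 ([recovery_bounds]), which gives the
    three limits. *)

Import Order.TTheory GRing.Theory Num.Theory.
Import numFieldNormedType.Exports.

Local Open Scope classical_set_scope.
Local Open Scope ring_scope.

(** * The Euclidean inner product *)

Section DotProduct.
Context {R : realType} {p : nat}.
Implicit Types (a : R) (u v w : 'rV[R]_p).

Lemma dotpC u v : dotp u v = dotp v u.
Proof. by apply: eq_bigr => i _; rewrite mulrC. Qed.

Lemma dotpDl u v w : dotp (u + v) w = dotp u w + dotp v w.
Proof. by rewrite -big_split; apply: eq_bigr => i _; rewrite mxE mulrDl. Qed.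

Lemma dotpZl a u v : dotp (a *: u) v = a * dotp u v.
Proof. by rewrite /dotp mulr_sumr; apply: eq_bigr => i _; rewrite mxE mulrA. Qed.

Lemma dotpDr u v w : dotp w (u + v) = dotp w u + dotp w v.
Proof. by rewrite dotpC dotpDl !(dotpC w). Qed.

Lemma dotpZr a u v : dotp v (a *: u) = a * dotp v u.
Proof. by rewrite dotpC dotpZl (dotpC v). Qed.

Lemma dotp_ge0 u : 0 <= dotp u u.
Proof. by apply: sumr_ge0 => i _; rewrite -expr2 sqr_ge0. Qed.

Lemma enorm_ge0 u : 0 <= enorm u.
Proof. exact: sqrtr_ge0. Qed.

Lemma sqr_enorm u : enorm u ^+ 2 = dotp u u.
Proof. by rewrite sqr_sqrtr ?dotp_ge0. Qed.

Lemma dotp_add4_le u v w z :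
  dotp (u + v + w + z) (u + v + w + z)
  <= 4 * (dotp u u + dotp v v + dotp w w + dotp z z).
Proof.
have H (x y : 'rV[R]_p) : 2 * dotp x y <= dotp x x + dotp y y.
  have := dotp_ge0 (x + (-1) *: y).
  rewrite !(dotpDl, dotpDr, dotpZl, dotpZr) (dotpC y x); lra.
have [[[[[h1 h2] h3] h4] h5] h6] := (H u v, H u w, H u z, H v w, H v z, H w z).
rewrite !(dotpDl, dotpDr) (dotpC v u) (dotpC w u) (dotpC z u) (dotpC w v).
rewrite (dotpC z v) (dotpC z w); lra.
Qed.

End DotProduct.

Definition dotpE {R : realType} {p : nat} :=
  (@dotpDl R p, @dotpDr R p, @dotpZl R p, @dotpZr R p).

(** * One step of the energy *)

Section Energy.
Context {R : realType} {p : nat}.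
Variables r om eta : R.
Implicit Types (c t : R) (u X w D e z : 'rV[R]_p).

(** The factor of [dotp w u] is the one for which [dotp D u] cancels in the
    increment, and that of [dotp u u] the one for which [dotp X u] cancels.  The
    last term cancels the [t ^+ 2 * dotp w D] produced by the first. *)
Definition energy c t u z w : R :=
  dotp (c *: u + z) (c *: u + z) + c * (r + 1 - c) * dotp u u
  + 2 * c * om * (t - 1) * dotp w u + (om * (t - 1)) ^+ 2 * dotp w w.

(** This is [t (y - x) + (om t - (r - 1) (om + beta)) w] along the scheme. *)
Definition momentum t X w D e : 'rV[R]_p :=
  t *: X + (eta * t) *: D + (eta * t) *: e + (om * (t + (r - 1))) *: w.

Definition dissipation t X w D e : R :=
  t * (dotp X X + dotp w w) + t ^+ 2 * (dotp D D + dotp e e).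

(** The vector added to [z] is the momentum update of the scheme.  By bilinearity
    this is a polynomial identity in the inner products of [u], [X], [w], [D] and
    [e]; [dotp D e] and [dotp w e] are grouped with the weights with which they
    occur in the square of [t D + (r - 1) w + t e], which bounds [e]. *)
Lemma energy_increment c t u X w D e :
  let z := momentum t X w D e in
  let s := r + 1 - c in
  energy c (t + 1) (u + X)
    (z + (- (r + 1)) *: X + (- (om * (r - 1))) *: w + (- (om * t)) *: D) (w + D)
  - energy c t u z w =
  - (2 * c * om * (r - 2)) * dotp w u
  - (2 * om ^+ 2 * (r - 2) * t + om ^+ 2 * ((r - 1) ^+ 2 + 1)) * dotp w w
  - s * (2 * t - s - c) * dotp X X
  - 2 * om * (eta - om) * t ^+ 2 * dotp D D
  - 2 * om * eta * (t ^+ 2 * dotp D e + (r - 1) * t * dotp w e)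
  - 2 * om * eta * (r - 1) * t * dotp w D
  - (2 * om * t ^+ 2 + 2 * (s * eta - s * om - c * om) * t) * dotp D X
  - 2 * s * eta * t * dotp X e
  - 2 * om * t * (r - 1 + s - c) * dotp X w.
Proof.
rewrite /energy /momentum /= !dotpE.
rewrite (dotpC X u) (dotpC u w) (dotpC D u) (dotpC e u) (dotpC w X) (dotpC X D).
rewrite (dotpC e X) (dotpC D w) (dotpC e w) (dotpC e D).
ring.
Qed.

Variables (rho kinv : R).

(** With [kinv = 1 / (L eta)^2], this is [2 * phi_hat * om * eta], the
    coefficient with which the step dissipates [t^2 |e|^2]. *)
Definition slack : R := om * eta * (kinv - 1).

Hypotheses (rho_ge0 : 0 <= rho) (om_gt0 : 0 < om) (r_gt2 : 2 < r).
Hypotheses (eta_gt : 2 * rho < eta - 2 * om) (kinv_gt1 : 1 < kinv).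

Let eta_gt0 : 0 < eta.
Proof. by move: rho_ge0 om_gt0 eta_gt; lra. Qed.

Let gap_gt0 : 0 < eta - 2 * om - 2 * rho.
Proof. by rewrite subr_gt0. Qed.

Lemma slack_gt0 : 0 < slack.
Proof. by rewrite /slack !mulr_gt0 ?subr_gt0. Qed.

Definition rate : R :=
  Num.min (Num.min (om ^+ 2 * (r - 2)) 1)
          (Num.min (om * (eta - 2 * om - 2 * rho) / 2) (slack / 2)).

Lemma rate_gt0 : 0 < rate.
Proof.
rewrite /rate !lt_min ltr01 mulr_gt0 ?exprn_gt0 ?subr_gt0 //=.
by rewrite !divr_gt0 ?slack_gt0 ?mulr_gt0.
Qed.

(** Beyond this value of t the leading terms of the increment dominate the
    others, for [c = r] and [c = 0] alike: the second bound concerns the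
    coefficient of [|w|^2], the third that of [|X|^2], the last that of
    [|D|^2]. *)
Definition threshold : R :=
  Num.max (Num.max (2 + r) ((2 * r * om * (r - 2) * rho + om * eta * (r - 1) ^+ 2)
     / (om ^+ 2 * (r - 2))))
   (Num.max (1 + r + (r + 1) * (2 * eta ^+ 2 / slack))
            (4 * (r + 1) * eta * rho / (om * (eta - 2 * om - 2 * rho)))).

Variables (t : R) (t_large : threshold <= t).

Let t_ge : 2 + r <= t.
Proof. by move: t_large; rewrite /threshold !ge_max -!andbA => /and4P[]. Qed.

Let t_ge_w : 2 * r * om * (r - 2) * rho + om * eta * (r - 1) ^+ 2
  <= om ^+ 2 * (r - 2) * t.
Proof.
move: t_large; rewrite /threshold !ge_max -!andbA => /and4P[_ + _ _].
by rewrite ler_pdivrMr ?mulr_gt0 ?exprn_gt0 ?subr_gt0 // [t * _]mulrC.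
Qed.

Let t_ge_X : 1 + r + (r + 1) * (2 * eta ^+ 2 / slack) <= t.
Proof. by move: t_large; rewrite /threshold !ge_max -!andbA => /and4P[]. Qed.

Let t_ge_D : 4 * (r + 1) * eta * rho <= om * (eta - 2 * om - 2 * rho) * t.
Proof.
move: t_large; rewrite /threshold !ge_max -!andbA => /and4P[_ _ _].
by rewrite ler_pdivrMr ?mulr_gt0 // [t * _]mulrC.
Qed.

Variables u X w D e : 'rV[R]_p.
Hypothesis XD_mono : 0 <= dotp D X + rho * dotp D D.
Hypothesis e_small : kinv * t ^+ 2 * dotp e e <=
  dotp (t *: D + (r - 1) *: w + t *: e) (t *: D + (r - 1) *: w + t *: e).

Let next_momentum := momentum t X w D e
  + (- (r + 1)) *: X + (- (om * (r - 1))) *: w + (- (om * t)) *: D.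

(** Expanding the square on the right of the Lipschitz bound turns an upper
    bound on [|e|^2] into a lower bound on the cross product of [e] with
    [t D + (r - 1) w], which is the one occurring in the increment. *)
Let lip_cross : 0 <=
  om * eta * (t ^+ 2 * dotp D D + 2 * (r - 1) * t * dotp w D
    + (r - 1) ^+ 2 * dotp w w)
  + 2 * om * eta * (t ^+ 2 * dotp D e + (r - 1) * t * dotp w e)
  - slack * t ^+ 2 * dotp e e.
Proof.
have h : 0 <= om * eta by rewrite mulr_ge0 ?ltW.
move: e_small; rewrite -subr_ge0 => /(mulr_ge0 h); rewrite !dotpE /slack.
by rewrite (dotpC D w) (dotpC e w) (dotpC e D); nra.
Qed.

Let young c : 0 <= slack / 2 * t ^+ 2 * dotp e e + 2 * c * eta * t * dotp X e
                    + 2 * c ^+ 2 * eta ^+ 2 / slack * dotp X X.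
Proof.
have s0 := slack_gt0.
have := dotp_ge0 ((slack * t) *: e + (2 * c * eta) *: X).
rewrite !dotpE (dotpC e X) -(pmulr_rge0 _ (_ : 0 < (2 * slack)^-1)); last first.
  by rewrite invr_gt0 mulr_gt0.
congr (_ <= _); field; lra.
Qed.

Lemma rate_le : rate * dissipation t X w D e <=
  om ^+ 2 * (r - 2) * t * dotp w w + t * dotp X X
  + om * (eta - 2 * om - 2 * rho) / 2 * t ^+ 2 * dotp D D
  + slack / 2 * t ^+ 2 * dotp e e.
Proof.
have [r1 r2 r3 r4] : [/\ rate <= om ^+ 2 * (r - 2), rate <= 1,
  rate <= om * (eta - 2 * om - 2 * rho) / 2 & rate <= slack / 2].
  by rewrite /rate !ge_min !lexx !orbT.
have t0 : 0 <= t by move: t_ge r_gt2; lra.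
have tt : 0 <= t ^+ 2 by exact: sqr_ge0.
have m (v : 'rV[R]_p) : 0 <= t * dotp v v by rewrite mulr_ge0 ?dotp_ge0.
have mm (v : 'rV[R]_p) : 0 <= t ^+ 2 * dotp v v by rewrite mulr_ge0 ?dotp_ge0.
have [[[h1 h2] h3] h4] := (ler_wpM2r (m w) r1, ler_wpM2r (m X) r2,
  ler_wpM2r (mm D) r3, ler_wpM2r (mm e) r4).
by rewrite /dissipation; lra.
Qed.

(** For [c = r] the coefficient of [dotp X w] vanishes, so that every remaining
    cross term is covered by monotonicity, by the Lipschitz bound, or by half of
    the slack. *)
Lemma energy_descent (uw_mono : 0 <= dotp w u + rho * dotp w w) :
  energy r (t + 1) (u + X) next_momentum (w + D)
  <= energy r t u (momentum t X w D e) w - rate * dissipation t X w D e.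
Proof.
have [t0 tr] : 0 <= t /\ 0 <= t - (1 + r) by split; move: t_ge r_gt2; lra.
have := energy_increment r t u X w D e; rewrite /= -/next_momentum => dE.
have h1 : 0 <= 2 * r * om * (r - 2) * (dotp w u + rho * dotp w w).
  by rewrite mulr_ge0 // ltW // !mulr_gt0 ?subr_gt0 //; move: r_gt2; lra.
have h2 : 0 <= (2 * om * t ^+ 2 + 2 * (eta - om - r * om) * t)
               * (dotp D X + rho * dotp D D).
  have -> : 2 * om * t ^+ 2 + 2 * (eta - om - r * om) * t
    = 2 * t * (om * (t - (1 + r)) + eta) by ring.
  by rewrite mulr_ge0 // mulr_ge0 ?mulr_ge0 // addr_ge0 ?mulr_ge0 // ltW.
have h3 := lip_cross; have h4 := young 1.
have h5 := dotp_ge0 w; have h6 := dotp_ge0 X; have h7 := dotp_ge0 D.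
have h8 : 0 <= (om ^+ 2 * (r - 2) * t
  - (2 * r * om * (r - 2) * rho + om * eta * (r - 1) ^+ 2)) * dotp w w.
  by rewrite mulr_ge0 // subr_ge0.
have h9 : 0 <= (t - (1 + r) - 2 * eta ^+ 2 / slack) * dotp X X.
  rewrite mulr_ge0 //; move: t_ge_X.
  have : 0 <= 2 * eta ^+ 2 / slack.
    by apply: divr_ge0; [rewrite mulr_ge0 ?sqr_ge0 | exact/ltW/slack_gt0].
  move: r_gt2; set A := 2 * eta ^+ 2 / slack => ? ?; nra.
have h10 : 0 <= (om * (eta - 2 * om - 2 * rho) / 2 * t - 2 * eta * rho) * (t * dotp D D).
  rewrite mulr_ge0 //; last by rewrite mulr_ge0.
  have : 0 <= r * (eta * rho) by rewrite !mulr_ge0 // ?ltW //; move: r_gt2; lra.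
  by move: t_ge_D; lra.
have h11 : 0 <= (om + r * om) * rho * (t * dotp D D).
  by rewrite !mulr_ge0 // addr_ge0 ?mulr_ge0 // ltW //; move: r_gt2; lra.
have h12 : 0 <= om ^+ 2 * ((r - 1) ^+ 2 + 1) * dotp w w.
  by rewrite mulr_ge0 // mulr_ge0 ?addr_ge0 ?sqr_ge0.
have h13 := rate_le.
move: (energy r (t + 1) _ _ _) (energy r t _ _ _) dE h13 => E1 E0.
set b := dissipation _ _ _ _ _ => dE h13.
set A := 2 * eta ^+ 2 / slack in h9.
have Aeq : 2 * 1 ^+ 2 * eta ^+ 2 / slack = A by rewrite /A; congr (_ / _); ring.
rewrite Aeq in h4.
lra.
Qed.

(** For [c = 0] no inner product with [u] is left; the price is a cross term
    [t <X, w>] of indefinite sign, which the dissipation bounds. *)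
Lemma potential_growth :
  energy 0 (t + 1) (u + X) next_momentum (w + D)
  <= energy 0 t u (momentum t X w D e) w
     + 2 * r * om * dissipation t X w D e.
Proof.
have [t0 tr] : 0 <= t /\ 0 <= t - (1 + r) by split; move: t_ge r_gt2; lra.
have r0 : 0 <= r + 1 by move: r_gt2; lra.
have := energy_increment 0 t u X w D e; rewrite /= -/next_momentum => dE.
have h2 : 0 <= (2 * om * t ^+ 2 + 2 * (r + 1) * (eta - om) * t)
               * (dotp D X + rho * dotp D D).
  have eta_om : 0 <= eta - om by move: rho_ge0 om_gt0 eta_gt; lra.
  rewrite mulr_ge0 // addr_ge0 // !mulr_ge0 ?sqr_ge0 //; exact: ltW.
have h3 := lip_cross; have h4 := young (r + 1).
have h5 := dotp_ge0 w; have h6 := dotp_ge0 X; have h7 := dotp_ge0 D.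
have h14 : 0 <= slack / 2 * t ^+ 2 * dotp e e.
  have s0 : 0 <= slack / 2 by rewrite divr_ge0 // ltW ?slack_gt0.
  by rewrite mulr_ge0 ?dotp_ge0 // mulr_ge0 ?sqr_ge0.
have h8 : 0 <= (om ^+ 2 * (r - 2) * t
  - (2 * r * om * (r - 2) * rho + om * eta * (r - 1) ^+ 2)) * dotp w w.
  by rewrite mulr_ge0 // subr_ge0.
have h1 : 0 <= 2 * r * om * (r - 2) * rho * dotp w w.
  rewrite mulr_ge0 // mulr_ge0 //; apply/ltW.
  by rewrite !mulr_gt0 ?subr_gt0 //; move: r_gt2; lra.
have h15 : 0 <= om ^+ 2 * (r - 2) * t * dotp w w.
  have [om0 r2] : 0 <= om /\ 0 <= r - 2 by rewrite subr_ge0 !ltW.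
  by rewrite !mulr_ge0.
have h9 : 0 <= (r + 1) * (t - (1 + r) - (r + 1) * (2 * eta ^+ 2 / slack)) * dotp X X.
  by rewrite !mulr_ge0 //; move: t_ge_X; lra.
have h16 : 0 <= (r + 1) * t * dotp X X by rewrite !mulr_ge0.
have h10 : 0 <= (om * (eta - 2 * om - 2 * rho) * t - 4 * (r + 1) * eta * rho) * (t * dotp D D).
  by rewrite mulr_ge0 ?subr_ge0 // mulr_ge0.
have h11 : 0 <= (r + 1) * (om + eta) * rho * (t * dotp D D).
  by rewrite !mulr_ge0 // addr_ge0 // ltW.
have h12 : 0 <= om ^+ 2 * ((r - 1) ^+ 2 + 1) * dotp w w.
  by rewrite mulr_ge0 // mulr_ge0 ?addr_ge0 ?sqr_ge0.
have h13 : 2 * r * om * (t * (dotp X X + dotp w w))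
           <= 2 * r * om * dissipation t X w D e.
  rewrite ler_wpM2l ?mulr_ge0 //; try by move: r_gt2 om_gt0; lra.
  by rewrite /dissipation lerDl mulr_ge0 ?sqr_ge0 ?addr_ge0 ?dotp_ge0.
have h17 : 0 <= 2 * r * om * t * dotp (X + w) (X + w).
  by rewrite !mulr_ge0 ?dotp_ge0 //; move: r_gt2 om_gt0; lra.
rewrite !dotpE (dotpC w X) in h17.
move: (energy 0 (t + 1) _ _ _) (energy 0 t _ _ _) dE h13 => E1 E0.
set b := dissipation _ _ _ _ _ => dE h13.
set A := 2 * eta ^+ 2 / slack in h9.
have Aeq : 2 * (r + 1) ^+ 2 * eta ^+ 2 / slack = (r + 1) ^+ 2 * A.
  by rewrite /A mulrA; congr (_ / _); ring.
rewrite Aeq in h4.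
lra.
Qed.

(** The inner product with [u] has a factor of order t and is bounded below by
    [- rho |w|^2], so the term in [t^2 |w|^2] absorbs it. *)
Lemma energy_ge0 z :
  0 <= dotp w u + rho * dotp w w -> 2 * r * rho <= om * (t - 1) ->
  0 <= energy r t u z w.
Proof.
move=> uw tl; rewrite /energy.
have t1 : 0 <= t - 1 by move: t_ge r_gt2; lra.
have r0 : 0 <= r by move: r_gt2; lra.
have h1 : 0 <= 2 * r * om * (t - 1) * (dotp w u + rho * dotp w w).
  by rewrite !mulr_ge0 // ltW.
have h2 : 0 <= (om * (t - 1) - 2 * r * rho) * (om * (t - 1) * dotp w w).
  by rewrite mulr_ge0 ?subr_ge0 ?mulr_ge0 ?dotp_ge0 // ltW.
have h3 : 0 <= r * dotp u u by rewrite mulr_ge0 ?dotp_ge0.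
have := dotp_ge0 (r *: u + z); lra.
Qed.

(** For [r - 1 <= t] the coefficient of [w] in the momentum is at most [2 om t],
    whence the constant: 17 is 4 * 2 ^ 2 + 1. *)
Lemma potential_le :
  energy 0 t u (momentum t X w D e) w
  <= (4 + 4 * eta ^+ 2 + 17 * om ^+ 2) * (t * dissipation t X w D e).
Proof.
have t1 : 1 <= t by move: t_ge r_gt2; lra.
rewrite /energy scale0r add0r !(mul0r, mulr0) !addr0.
have := dotp_add4_le (t *: X) ((eta * t) *: D) ((eta * t) *: e) ((om * (t + (r - 1))) *: w).
rewrite -/(momentum t X w D e) !(dotpZl, dotpZr) /dissipation.
move: (dotp (momentum _ _ _ _ _) _) => Z hZ.
have [X0 D0 e0 w0] := And4 (dotp_ge0 X) (dotp_ge0 D) (dotp_ge0 e) (dotp_ge0 w).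
have a1 : 0 <= om ^+ 2 * (4 * t ^+ 2 - (t + (r - 1)) ^+ 2) * dotp w w.
  rewrite mulr_ge0 // mulr_ge0 ?sqr_ge0 //.
  have -> : 4 * t ^+ 2 - (t + (r - 1)) ^+ 2 = (t - (r - 1)) * (3 * t + r - 1) by ring.
  by rewrite mulr_ge0 //; move: t_ge r_gt2; lra.
have a2 : 0 <= om ^+ 2 * (t ^+ 2 - (t - 1) ^+ 2) * dotp w w.
  rewrite mulr_ge0 // mulr_ge0 ?sqr_ge0 //.
  have -> : t ^+ 2 - (t - 1) ^+ 2 = 2 * t - 1 by ring.
  by lra.
have [t0 eta0 om0] : [/\ 0 <= t, 0 <= eta & 0 <= om] by rewrite !ltW // (lt_le_trans ltr01).
have [e2 o2] : 0 <= eta ^+ 2 /\ 0 <= om ^+ 2 by rewrite !sqr_ge0.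
have de0 : 0 <= dotp D D + dotp e e by rewrite addr_ge0.
have a3 : 0 <= (t - 1) * t ^+ 2 * (dotp D D + dotp e e) * (4 * eta ^+ 2).
  by rewrite !mulr_ge0 ?subr_ge0.
have a4 : 0 <= t * t ^+ 2 * (dotp D D + dotp e e) * (4 + 17 * om ^+ 2).
  by rewrite mulr_ge0 ?mulr_ge0 //; lra.
have a5 : 0 <= t ^+ 2 * dotp X X * (4 * eta ^+ 2 + 17 * om ^+ 2).
  by rewrite mulr_ge0 ?mulr_ge0 //; lra.
have a6 : 0 <= t ^+ 2 * dotp w w * (4 * eta ^+ 2 + 4).
  by rewrite mulr_ge0 ?mulr_ge0 //; lra.
lra.
Qed.

(** With E the energy for [c = 0] and b the dissipation, t >= 2 gives
    [om^2 t^2 |w|^2 <= 4 E]; then [t^2 |X|^2 <= 68 E + 4 eta^2 b], where 68 is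
    4 * (1 + 16); the bound on [t (y - x)] adds [eta^2 b] and
    [eta^2 (r - 1)^2 |w|^2 <= (4 eta^2 / om^2) E].  The constant covers the
    three bounds at once. *)
Definition recovery : R :=
  4 * (68 + 5 * eta ^+ 2 + 4 * eta ^+ 2 / om ^+ 2) + 4 / om ^+ 2.

(** The energy for [c = 0] controls z and [t w], and the dissipation controls
    [t D] and [t e]; [X] is then recovered from the definition of z, and [pt],
    which is [t (y - x)] along the scheme, from [X]. *)
Lemma recovery_bounds :
  let b := energy 0 t u (momentum t X w D e) w + dissipation t X w D e in
  let pt := t *: X + (eta * t) *: D + (eta * t) *: e + (eta * (r - 1)) *: w in
  [/\ t ^+ 2 * dotp w w <= recovery * b, t ^+ 2 * dotp X X <= recovery * b
    & dotp pt pt <= recovery * b].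
Proof.
have t1 : 1 <= t by move: t_ge r_gt2; lra.
move=> b pt; rewrite /recovery.
have := dotp_add4_le (t *: X) ((eta * t) *: D) ((eta * t) *: e) ((eta * (r - 1)) *: w).
rewrite -/pt; move: (dotp pt pt) => P hP.
have := dotp_add4_le (momentum t X w D e) ((- (eta * t)) *: D)
   ((- (eta * t)) *: e) ((- (om * (t + (r - 1)))) *: w).
have -> : momentum t X w D e + (- (eta * t)) *: D + (- (eta * t)) *: e
          + (- (om * (t + (r - 1)))) *: w = t *: X.
  by rewrite /momentum; apply/rowP => i; rewrite !mxE; ring.
move: hP; rewrite /b /energy scale0r add0r !(mul0r, mulr0) !addr0.
have Z0 := dotp_ge0 (momentum t X w D e).
move: Z0; rewrite !(dotpZl, dotpZr) /dissipation.
move: (dotp (momentum _ _ _ _ _) _) => Z Z0 hP hX.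
have [X0 D0 e0 w0] := And4 (dotp_ge0 X) (dotp_ge0 D) (dotp_ge0 e) (dotp_ge0 w).
set E := Z + _; set B := t * _ + _.
have E0 : 0 <= E by rewrite addr_ge0 // mulr_ge0 ?sqr_ge0.
have t0 : 0 <= t by rewrite (le_trans ler01).
have B0 : 0 <= B by rewrite addr_ge0 // mulr_ge0 ?addr_ge0 // sqr_ge0.
have DeB : t ^+ 2 * (dotp D D + dotp e e) <= B.
  by rewrite lerDr mulr_ge0 // addr_ge0.
have ZE : Z <= E by rewrite lerDl mulr_ge0 ?sqr_ge0.
have wE : om ^+ 2 * (t ^+ 2 * dotp w w) <= 4 * E.
  have a1 : 0 <= om ^+ 2 * (4 * (t - 1) ^+ 2 - t ^+ 2) * dotp w w.
    rewrite mulr_ge0 // mulr_ge0 ?sqr_ge0 //.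
    have -> : 4 * (t - 1) ^+ 2 - t ^+ 2 = (t - 2) * (3 * t - 2) by ring.
    by rewrite mulr_ge0 //; move: t_ge r_gt2; lra.
  by rewrite /E; lra.
have wE' : t ^+ 2 * dotp w w <= 4 / om ^+ 2 * E.
  by rewrite [leRHS]mulrAC ler_pdivlMr ?exprn_gt0 // mulrC.
have wq : om ^+ 2 * (t + (r - 1)) ^+ 2 * dotp w w <= 16 * E.
  have a1 : 0 <= om ^+ 2 * (4 * t ^+ 2 - (t + (r - 1)) ^+ 2) * dotp w w.
    rewrite mulr_ge0 // mulr_ge0 ?sqr_ge0 //.
    have -> : 4 * t ^+ 2 - (t + (r - 1)) ^+ 2 = (t - (r - 1)) * (3 * t + r - 1) by ring.
    by rewrite mulr_ge0 //; move: t_ge r_gt2; lra.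
  lra.
have eta2 : 0 <= eta ^+ 2 by exact: sqr_ge0.
have eB : eta ^+ 2 * (t ^+ 2 * (dotp D D + dotp e e)) <= eta ^+ 2 * B.
  by rewrite ler_wpM2l.
have XE : t ^+ 2 * dotp X X <= 68 * E + 4 * eta ^+ 2 * B by lra.
have q_le : eta ^+ 2 * (r - 1) ^+ 2 * dotp w w <= eta ^+ 2 * (4 / om ^+ 2 * E).
  rewrite -mulrA ler_wpM2l //; apply: le_trans wE'.
  by rewrite ler_wpM2r // lerXn2r ?nnegrE //; move: t_ge r_gt2; lra.
have PE : P <= 4 * (68 * E + 5 * eta ^+ 2 * B + eta ^+ 2 * (4 / om ^+ 2 * E)) by lra.
have k0 : 0 <= 4 / om ^+ 2 by rewrite divr_ge0 ?sqr_ge0.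
move: wE' PE q_le; have -> : 4 * eta ^+ 2 / om ^+ 2 = eta ^+ 2 * (4 / om ^+ 2).
  by rewrite [RHS]mulrA (mulrC 4).
move: (4 / om ^+ 2) k0 => k k0 wE' PE q_le.
have kE : 0 <= k * E by rewrite mulr_ge0.
have kB : 0 <= k * B by rewrite mulr_ge0.
have eE : 0 <= eta ^+ 2 * E by rewrite mulr_ge0.
have eB0 : 0 <= eta ^+ 2 * B by rewrite mulr_ge0.
have ekE : 0 <= eta ^+ 2 * (k * E) by rewrite mulr_ge0.
have ekB : 0 <= eta ^+ 2 * (k * B) by rewrite mulr_ge0.
by split; lra.
Qed.
End Energy.

(** * Sequences with a dissipated energy *)

Lemma eventually_cvg_nonincreasing (R : realType) (f : nat -> R) :
  (\forall k \near \oo, 0 <= f k) ->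
  (\forall k \near \oo, f k.+1 <= f k) -> cvgn f.
Proof.
move=> f0 fS.
have [N _ HN] : \forall k \near \oo, 0 <= f k /\ f k.+1 <= f k.
  by near=> k; split; near: k.
suff /cvg_ex[l] : cvgn (fun n => f (n + N)%N).
  by rewrite (cvg_shiftn N) => /cvgP.
apply: nonincreasing_is_cvgn.
  by apply/nonincreasing_seqP => n; case: (HN (n + N)%N (leq_addl _ _)).
exists 0 => _ [n _ <-]; by case: (HN (n + N)%N (leq_addl _ _)).
Unshelve. all: by end_near. Qed.

(** Both [E] and [a + (M / m) E] are eventually nonincreasing and nonnegative, so
    [a] converges.  A positive limit would force [b k] above a multiple of
    [1 / k], and [E] would drop by a fixed amount between k and 2k, which
    contradicts its convergence. *)
Lemma lyapunov_vanish (R : realType) (E a b : nat -> R) (m M t0 : R) :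
  0 < m -> 0 < M ->
  (\forall k \near \oo, [/\ 0 <= E k, 0 <= a k & 0 <= b k]) ->
  (\forall k \near \oo, E k.+1 <= E k - m * b k) ->
  (\forall k \near \oo, a k.+1 <= a k + M * b k) ->
  (\forall k \near \oo, a k <= M * ((k%:R + t0) * b k)) ->
  a @ \oo --> (0 : R) /\ b @ \oo --> (0 : R).
Proof.
move=> m0 M0 pos ES aS ab.
have Ecvg : cvgn E.
  apply: eventually_cvg_nonincreasing.
    by apply: filterS pos => k [].
  apply: filterS2 pos ES => k [_ _ b0] h.
  by rewrite (le_trans h) // gerBl mulr_ge0 // ltW.
have ESl : (fun k => E k.+1) @ \oo --> limn E by rewrite cvg_shiftS.
have bcvg : b @ \oo --> (0 : R).
  have dE : (fun k => m^-1 * (E k - E k.+1)) @ \oo --> (0 : R).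
    rewrite -(mulr0 m^-1) -(subrr (limn E)).
    by apply: cvgM; [exact: cvg_cst | apply: cvgB].
  apply: (squeeze_cvgr _ (cvg_cst (0 : R)) dE).
  apply: filterS2 pos ES => k [_ _ b0] h; rewrite b0 /=.
  by rewrite mulrC ler_pdivlMr // mulrC; lra.
split=> //.
have Mm0 : 0 <= M / m by rewrite divr_ge0 // ltW.
have Gcvg : cvgn (fun k => a k + M / m * E k).
  apply: eventually_cvg_nonincreasing.
    by apply: filterS pos => k [E0 a0 _]; rewrite addr_ge0 // mulr_ge0.
  apply: filterS2 ES aS => k hE ha; rewrite -subr_ge0.
  have -> : a k + M / m * E k - (a k.+1 + M / m * E k.+1)
     = (a k + M * b k - a k.+1) + M / m * (E k - m * b k - E k.+1).
    by field; rewrite gt_eqF.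
  by rewrite addr_ge0 ?subr_ge0 // mulr_ge0 // subr_ge0.
have acvg : cvgn a.
  have -> : a = (fun k => (a k + M / m * E k) - M / m * E k).
    by apply/funext => k; rewrite addrK.
  by apply: is_cvgB => //; apply: is_cvgM => //; exact: is_cvg_cst.
have l0 : 0 <= limn a.
  by apply: limr_ge => //; apply: filterS pos => k [].
have [l_eq0 | lne] := eqVneq (limn a) 0; first by rewrite -l_eq0.
exfalso; have {l0 lne} lgt0 : 0 < limn a by rewrite lt_neqAle eq_sym lne.
set l := limn a in lgt0.
(* Between k and 2k the factor k + t0 is at most 3k and a is at least l / 2, so
   that each step costs at least c / (3k), in total c / 3. *)
pose c := m * l / (2 * M).
have c0 : 0 < c by rewrite divr_gt0 ?mulr_gt0.
have [N _ HN] : \forall k \near \oo, [/\ l / 2 <= a k, `|t0| + 1 <= k%:R,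
   a k <= M * ((k%:R + t0) * b k), E k.+1 <= E k - m * b k & `|limn E - E k| < c / 6].
  near=> k; split; near: k => //.
  - by apply: (cvgr_ge l acvg); rewrite ltr_pdivrMr // mulr_natr mulr2n ltrDl.
  - exact: nbhs_infty_ger.
  - by apply: cvgr_dist_lt => //; rewrite divr_gt0.
have kpos k : (N <= k)%N -> 1 <= k%:R :> R /\ `|t0| <= k%:R.
  by case/HN => _ h _ _ _; move: (normr_ge0 t0); lra.
have step k j : (N <= k <= j)%N -> (j <= 2 * k)%N -> E j.+1 <= E j - c / (3 * k%:R).
  move=> /andP[Nk kj] j2; have [k1 tk] := kpos k Nk.
  have [l2 _ ha hE _] := HN j (leq_trans Nk kj).
  rewrite (le_trans hE) // lerD2l lerN2 ler_pdivrMr ?mulr_gt0 ?(lt_le_trans ltr01 k1) //.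
  have jR : j%:R <= 2 * k%:R :> R by rewrite -natrM ler_nat.
  have kjR : k%:R <= j%:R :> R by rewrite ler_nat.
  have t0k : `|t0| <= k%:R by [].
  have [tlo thi] : - k%:R <= t0 /\ t0 <= k%:R by apply/andP; rewrite -ler_norml.
  have b0 : 0 < b j.
    rewrite ltNge; apply/negP => bn.
    have : M * ((j%:R + t0) * b j) <= 0.
      by rewrite mulr_ge0_le0 ?(ltW M0) // mulr_ge0_le0 //; lra.
    lra.
  have : (j%:R + t0) * b j <= 3 * k%:R * b j by rewrite ler_wpM2r ?(ltW b0) //; lra.
  rewrite /c ler_pdivrMr ?mulr_gt0 // => h.
  have h1 := ler_wpM2l (ltW M0) h.
  have h2 : l <= 2 * (M * (3 * k%:R * b j)) by lra.
  have := ler_wpM2l (ltW m0) h2; lra.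
have [N1 _] := kpos N (leqnn N).
have iter i : (i <= N)%N -> E (N + i)%N <= E N - i%:R * (c / (3 * N%:R)).
  elim: i => [|i IH] iN; first by rewrite addn0 mul0r subr0.
  rewrite addnS (le_trans (step N (N + i)%N _ _)) ?leqnn ?leq_addr //.
    by rewrite mul2n -addnn leq_add2l ltnW.
  move: (IH (ltnW iN)); set x := c / _; rewrite -[i.+1%:R]natr1 mulrDl mul1r; lra.
have := iter N (leqnn N).
have -> : N%:R * (c / (3 * N%:R)) = c / 3 by field; lra.
have [_ _ _ _ h1] := HN N (leqnn N).
have [_ _ _ _ h2] := HN (N + N)%N (leq_addr _ _).
move: h1 h2; rewrite !ltr_norml => /andP[? ?] /andP[? ?]; lra.
Unshelve. all: by end_near. Qed.

(** * The scheme in terms of momentum *)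

Section SchemeStep.
Context {R : realType} {p : nat}.
Variables (F : 'rV[R]_p -> 'rV[R]_p) (T : 'rV[R]_p -> set 'rV[R]_p).
Variables (r beta eta : R) (t : nat -> R) (x y xi : nat -> 'rV[R]_p).
Hypothesis scheme : AEG F T r beta eta t x y xi.
Hypothesis eta_neq0 : eta != 0.

Let om := omega beta eta.
Let w := w_seq F x xi.

Definition momentum_seq k : 'rV[R]_p :=
  t k *: (y k - x k) + (om * t k - (r - 1) * (om + beta)) *: w k.

Definition what_error k : 'rV[R]_p := what_seq F y xi k - w k.

Let X k := x k.+1 - x k.
Let D k := w k.+1 - w k.
Let e k := what_error k.+1.

Lemma scaled_direction k : t k != 0 ->
  t k *: d_seq F r t x y xi k = t k *: D k + (r - 1) *: w k + t k *: e k.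
Proof.
move=> tk; apply/rowP => i.
by rewrite /e /what_error /D /w /d_seq /gamma_ !mxE; field.
Qed.

Lemma gap_expansion k : t k != 0 ->
  t k *: (y k - x k) = t k *: X k + (eta * t k) *: D k
                       + (eta * t k) *: e k + (eta * (r - 1)) *: w k.
Proof.
move=> tk.
have -> : y k - x k = X k + eta *: d_seq F r t x y xi k.
  by rewrite /X addrAC (AEG_x scheme) subrK.
have -> : t k *: (X k + eta *: d_seq F r t x y xi k)
          = t k *: X k + eta *: (t k *: d_seq F r t x y xi k).
  by apply/rowP => i; rewrite !mxE; ring.
rewrite scaled_direction //; move: (X k) (D k) (w k) (e k) => X0 D0 w0 e0.
by apply/rowP => i; rewrite !mxE; ring.
Qed.

Lemma momentum_expansion k : t k != 0 ->
  momentum_seq k = momentum r om eta (t k) (X k) (w k) (D k) (e k).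
Proof.
move=> tk; rewrite /momentum_seq gap_expansion // /momentum /om /omega.
move: (X k) (D k) (w k) (e k) => X0 D0 w0 e0.
by apply/rowP => i; rewrite !mxE; field.
Qed.

(** Multiplied by [t k.+1], the last-but-one term of the update of [y] becomes
    [(eta * t k) *: what_seq k.+1], which is what [t k *: (x k.+1 - y k)]
    subtracts: [what_seq k.+1] survives only inside [X k].  The factor of [w k]
    in the definition of the momentum also absorbs the part of the increment
    proportional to [D k] without a factor [t k]. *)
Lemma momentum_step k : t k != 0 -> t k.+1 = t k + 1 -> t k.+1 != 0 ->
  momentum_seq k.+1 = momentum_seq k + (- (r + 1)) *: X k
    + (- (om * (r - 1))) *: w k + (- (om * t k)) *: D k.
Proof.
move=> tk tS; rewrite tS => tk1.
have hx := AEG_x scheme k; have hy := AEG_y scheme k.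
rewrite /momentum_seq /X /D /om /omega tS; apply/rowP => i.
have := congr1 (fun v : 'rV[R]_p => v 0 i) hy.
have := congr1 (fun v : 'rV[R]_p => v 0 i) hx.
rewrite /d_seq /theta_ /eta_ /lambda_ /nu_ /gamma_ /delta tS -/w.
move: (w k) (w k.+1) (what_seq F y xi k.+1) => w0 w1 wh.
rewrite !mxE => ex ey; rewrite ey.
have -> : x k.+1 0 i = y k 0 i - eta * (wh 0 i + - ((t k - r + 1) / t k * w0 0 i)).
  by [].
by field; rewrite tk tk1.
Qed.

Lemma AEG_T k : T (x k) (xi k).
Proof.
case: k => [|k]; first exact: AEG_xi0 scheme.
have : resolvent eta T (forward_point F r eta t x y xi k) (x k.+1).
  by rewrite (AEG_resolvent scheme).
case=> v Tv def; rewrite (AEG_xi scheme) def addrAC subrr add0r.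
by rewrite scalerA mulVf // scale1r.
Qed.

Lemma gra_w k : gra (op_sum F T) (x k, w k).
Proof. by exists (xi k) => //; exact: AEG_T. Qed.

Lemma w_mono rho k : cohypomonotone rho (op_sum F T) ->
  0 <= dotp (D k) (X k) + rho * dotp (D k) (D k).
Proof.
move=> /(_ _ _ _ _ (gra_w k.+1) (gra_w k)); rewrite sqr_enorm /X /D; lra.
Qed.

Lemma w_zer_mono rho xs k : cohypomonotone rho (op_sum F T) ->
  zer (op_sum F T) xs ->
  0 <= dotp (w k) (x k - xs) + rho * dotp (w k) (w k).
Proof.
by move=> mono xs0; have := mono _ _ _ _ (gra_w k) xs0; rewrite sqr_enorm subr0; lra.
Qed.

(** The error is [F (y k) - F (x k.+1)], and [y k - x k.+1] is [eta] times the
    direction of the step. *)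
Lemma what_error_le L k : 0 <= L -> elipschitz L F -> t k != 0 ->
  t k ^+ 2 * dotp (e k) (e k) <= L ^+ 2 * eta ^+ 2 *
  dotp (t k *: D k + (r - 1) *: w k + t k *: e k)
       (t k *: D k + (r - 1) *: w k + t k *: e k).
Proof.
move=> L0 Flip tk; rewrite -scaled_direction //.
have -> : e k = F (y k) - F (x k.+1).
  by rewrite /e /what_error /w /what_seq /w_seq /= opprD addrACA subrr addr0.
have /= := Flip (y k) (x k.+1).
rewrite -ler_sqr ?nnegrE ?mulr_ge0 ?enorm_ge0 // exprMn !sqr_enorm.
have -> : y k - x k.+1 = eta *: d_seq F r t x y xi k.
  by rewrite (AEG_x scheme) opprB addrC subrK.
move=> /(ler_wpM2l (sqr_ge0 (t k))); rewrite !(dotpZl, dotpZr).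
by move=> /le_trans; apply; rewrite le_eqVlt; apply/orP; left; apply/eqP; ring.
Qed.

End SchemeStep.

Arguments gap_expansion {R p F T r beta eta t x y xi} scheme {k}.
Arguments momentum_expansion {R p F T r beta eta t x y xi} scheme {k}.
Arguments momentum_step {R p F T r beta eta t x y xi} scheme {k}.
Arguments w_mono {R p F T r beta eta t x y xi} scheme _ {rho}.
Arguments w_zer_mono {R p F T r beta eta t x y xi} scheme _ {rho xs}.
Arguments what_error_le {R p F T r beta eta t x y xi} scheme {L k}.

(** * Rates of convergence *)

Lemma littleo_of_scaled_sqr (R : realType) (f : nat -> R) :
  (forall k, 0 <= f k) ->
  (fun k : nat => k%:R ^+ 2 * f k ^+ 2) @ \oo --> (0 : R) ->
  f =o_\oo (fun k : nat => k%:R^-1 : R).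
Proof.
move=> f0 cvgf; apply/eqoP => eps eps0.
have small : \forall k \near \oo, `|0 - k%:R ^+ 2 * f k ^+ 2| <= eps ^+ 2.
  by move/cvgrPdist_le : cvgf => /(_ (eps ^+ 2)); apply; rewrite exprn_gt0.
near=> k.
have k0 : 0 < k%:R :> R.
  by rewrite (lt_le_trans ltr01) //; near: k; exact: nbhs_infty_ger.
rewrite !ger0_norm ?invr_ge0 ?(ltW k0) // ler_pdivlMr //.
have : `|0 - k%:R ^+ 2 * f k ^+ 2| <= eps ^+ 2 by near: k; exact: small.
rewrite sub0r normrN ger0_norm ?mulr_ge0 ?sqr_ge0 // -exprMn.
by rewrite ler_sqr ?nnegrE ?mulr_ge0 ?(ltW k0) ?(ltW eps0) // mulrC.
Unshelve. all: by end_near. Qed.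

(** The square of k is eventually at most four times that of k + t0. *)
Lemma scaled_sqr_vanish (R : realType) (p : nat) (v : nat -> 'rV[R]_p)
    (t0 C : R) (g : nat -> R) :
  g @ \oo --> (0 : R) ->
  (\forall k \near \oo, (k%:R + t0) ^+ 2 * dotp (v k) (v k) <= C * g k) ->
  (fun k : nat => k%:R ^+ 2 * enorm (v k) ^+ 2) @ \oo --> (0 : R).
Proof.
move=> g0 bnd.
have Cg0 : (fun k => 4 * C * g k) @ \oo --> (0 : R).
  by rewrite -(mulr0 (4 * C)); apply: cvgM => //; exact: cvg_cst.
apply: (squeeze_cvgr _ (cvg_cst (0 : R)) Cg0).
near=> k; rewrite sqr_enorm mulr_ge0 ?sqr_ge0 ?dotp_ge0 //=.
have kt : 2 * `|t0| <= k%:R by near: k; exact: nbhs_infty_ger.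
have k2 : k%:R ^+ 2 <= 4 * (k%:R + t0) ^+ 2 :> R.
  have -> : 4 * (k%:R + t0) ^+ 2 = (2 * (k%:R + t0)) ^+ 2 by ring.
  have tlo : - `|t0| <= t0 by rewrite lerNnormlW.
  have k0 : 0 <= k%:R :> R by [].
  by rewrite lerXn2r ?nnegrE //; lra.
have bk : (k%:R + t0) ^+ 2 * dotp (v k) (v k) <= C * g k by near: k.
have := ler_wpM2r (dotp_ge0 (v k)) k2; lra.
Unshelve. all: by end_near. Qed.

Theorem theorem7p2 (R : realType) (p : nat)
    (F : 'rV[R]_p -> 'rV[R]_p) (T : 'rV[R]_p -> set 'rV[R]_p)
    (L rho r beta eta : R) (x y xi : nat -> 'rV[R]_p)
    (L_gt0 : 0 < L) (rho_ge0 : 0 <= rho)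
    (zer_neq0 : zer (op_sum F T) !=set0)
    (F_lip : elipschitz L F)
    (Phi_cohypo : cohypomonotone rho (op_sum F T))
    (Lrho_lt1 : 2 * L * rho < 1)
    (r_gt2 : 2 < r)
    (beta_gt : 2 * rho < beta) (beta_lt_eta : beta < eta) (eta_lt : eta < 1 / L)
    (J_single : forall z, exists v, resolvent eta T z = [set v])
    (scheme : AEG F T r beta eta (t_seq L rho r beta eta) x y xi) :
  [/\ (fun k : nat => k%:R ^+ 2 * enorm (F (x k) + xi k) ^+ 2) @ \oo --> (0 : R),
      (fun k : nat => k%:R ^+ 2 * enorm (x k.+1 - x k) ^+ 2) @ \oo --> (0 : R) &
      (fun k : nat => k%:R ^+ 2 * enorm (y k - x k) ^+ 2) @ \oo --> (0 : R)] /\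
  [/\ (fun k : nat => enorm (F (x k) + xi k)) =o_\oo (fun k : nat => k%:R^-1 : R),
      (fun k : nat => enorm (x k.+1 - x k)) =o_\oo (fun k : nat => k%:R^-1 : R) &
      (fun k : nat => enorm (y k - x k)) =o_\oo (fun k : nat => k%:R^-1 : R)].
Proof.
suff [cw cX cy] :
  [/\ (fun k : nat => k%:R ^+ 2 * enorm (F (x k) + xi k) ^+ 2) @ \oo --> (0 : R),
      (fun k : nat => k%:R ^+ 2 * enorm (x k.+1 - x k) ^+ 2) @ \oo --> (0 : R) &
      (fun k : nat => k%:R ^+ 2 * enorm (y k - x k) ^+ 2) @ \oo --> (0 : R)].
  by split; split=> //; apply: littleo_of_scaled_sqr => // k; exact: enorm_ge0.
have [xs xs_zer] := zer_neq0.
set t := t_seq _ _ _ _ _ in scheme.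
pose om := omega beta eta.
have om0 : 0 < om by rewrite /om /omega; lra.
have gap : 2 * rho < eta - 2 * om by rewrite /om /omega; lra.
have eta0 : 0 < eta by lra.
have eta_neq0 : eta != 0 by rewrite gt_eqF.
pose kinv := (L ^+ 2 * eta ^+ 2)^-1.
have Le0 : 0 < L ^+ 2 * eta ^+ 2 by rewrite mulr_gt0 ?exprn_gt0.
have kinv1 : 1 < kinv.
  rewrite invf_gt1 // -exprMn expr_lt1 ?mulr_ge0 ?ltW //.
  by move: eta_lt; rewrite ltr_pdivlMr // mulrC.
pose w k := w_seq F x xi k.
pose X k := x k.+1 - x k.
pose D k := w k.+1 - w k.
pose e k := what_error F x y xi k.+1.
pose z := momentum_seq F r beta eta t x y xi.
pose E k := energy r om r (t k) (x k - xs) (z k) (w k).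
pose a k := energy r om 0 (t k) (x k - xs) (z k) (w k).
pose b k := dissipation (t k) (X k) (w k) (D k) (e k).
have t_ge A : \forall k \near \oo, A <= t k.
  by near=> k; rewrite /t /t_seq -lerBlDr; near: k; exact: nbhs_infty_ger.
have tS k : t k.+1 = t k + 1 by rewrite /t /t_seq -natr1 addrAC.
have large : \forall k \near \oo,
    [/\ threshold r om eta rho kinv <= t k, 2 * r * rho / om + 1 <= t k & 1 <= t k].
  by near=> k; split; near: k; exact: t_ge.
have t_neq0 k : 1 <= t k -> t k != 0 by move=> h; rewrite gt_eqF //; lra.
have tS_neq0 k : 1 <= t k -> t k.+1 != 0 by move=> h; rewrite tS gt_eqF //; lra.
have mono k := w_mono scheme eta_neq0 k Phi_cohypo.
have monos k := w_zer_mono scheme eta_neq0 k Phi_cohypo xs_zer.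
have e_small k : 1 <= t k -> kinv * t k ^+ 2 * dotp (e k) (e k) <=
    dotp (t k *: D k + (r - 1) *: w k + t k *: e k)
         (t k *: D k + (r - 1) *: w k + t k *: e k).
  move=> tk; have := what_error_le scheme (ltW L_gt0) F_lip (t_neq0 _ tk).
  by move=> h; rewrite -mulrA /kinv ler_pdivrMl.
have zE k : 1 <= t k -> z k = momentum r om eta (t k) (X k) (w k) (D k) (e k).
  by move=> tk; exact: (momentum_expansion scheme (t_neq0 _ tk)).
have zS k : 1 <= t k -> z k.+1 = momentum r om eta (t k) (X k) (w k) (D k) (e k)
    + (- (r + 1)) *: X k + (- (om * (r - 1))) *: w k + (- (om * t k)) *: D k.
  move=> tk; rewrite -zE //.
  exact: (momentum_step scheme (t_neq0 _ tk) (tS k) (tS_neq0 _ tk)).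
have xS k : x k.+1 - xs = (x k - xs) + X k by rewrite /X [RHS]addrC addrA subrK.
have wS k : w k.+1 = w k + D k by rewrite /D [RHS]addrC subrK.
pose m := rate r om eta rho kinv.
pose c1 := 2 * r * om.
pose c2 := 4 + 4 * eta ^+ 2 + 17 * om ^+ 2.
have b0 k : 1 <= t k -> 0 <= b k.
  move=> tk; have tk0 : 0 <= t k by lra.
  by rewrite addr_ge0 // mulr_ge0 ?sqr_ge0 // addr_ge0 ?dotp_ge0.
have c10 : 0 < c1 by rewrite !mulr_gt0 //; lra.
have c20 : 0 <= c2 by rewrite /c2; have := (sqr_ge0 eta); have := sqr_ge0 om; lra.
have [a_to0 b_to0] : a @ \oo --> (0 : R) /\ b @ \oo --> (0 : R).
  apply: (@lyapunov_vanish _ E a b m (c1 + c2) (t_zero L rho r beta eta)).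
  - exact: rate_gt0.
  - by rewrite ltr_wpDr.
  - apply: filterS large => k [tl tE tk]; split; last exact: b0.
      apply: (energy_ge0 _ _ _ _ _ om0 r_gt2 _ tl) => //.
      by move: tE; rewrite -lerBrDr ler_pdivrMr // [_ * om]mulrC.
    rewrite /a /energy !(mul0r, mulr0) !addr0.
    by rewrite addr_ge0 ?dotp_ge0 // mulr_ge0 ?dotp_ge0 ?sqr_ge0.
  - apply: filterS large => k [tl _ tk].
    rewrite /E zS // tS xS wS (zE k) //.
    exact: (energy_descent _ _ _ _ _ rho_ge0 om0 r_gt2 gap kinv1 _ tl _ _ _ _ _
            (mono k) (e_small k tk) (monos k)).
  - apply: filterS large => k [tl _ tk].
    have : a k.+1 <= a k + c1 * b k.
      rewrite /a zS // tS xS wS (zE k) //.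
      exact: (potential_growth _ _ _ _ _ rho_ge0 om0 r_gt2 gap kinv1 _ tl _ _ _ _ _
              (mono k) (e_small k tk)).
    by have := mulr_ge0 c20 (b0 k tk); lra.
  - apply: filterS large => k [tl _ tk].
    have : a k <= c2 * (t k * b k).
      rewrite /a (zE k) //.
      exact: (potential_le _ _ _ _ _ rho_ge0 om0 r_gt2 gap _ tl).
    have tk0 : 0 <= t k by lra.
    have := mulr_ge0 (ltW c10) (mulr_ge0 tk0 (b0 k tk)).
    by rewrite -[k%:R + _]/(t k); lra.
have ab0 : (fun k => a k + b k) @ \oo --> (0 : R).
  by rewrite -(addr0 0); exact: cvgD.
have recover : \forall k \near \oo, [/\
    t k ^+ 2 * dotp (w k) (w k) <= recovery om eta * (a k + b k),
    t k ^+ 2 * dotp (X k) (X k) <= recovery om eta * (a k + b k) &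
    t k ^+ 2 * dotp (y k - x k) (y k - x k) <= recovery om eta * (a k + b k)].
  apply: filterS large => k [tl _ tk].
  have := recovery_bounds _ _ _ _ _ om0 r_gt2 _ tl (x k - xs) (X k) (w k) (D k) (e k).
  rewrite -(gap_expansion scheme (t_neq0 _ tk)) /a (zE k) //.
  rewrite !(dotpZl, dotpZr) mulrA -expr2.
  by apply.
split; apply: (scaled_sqr_vanish _ _ _ _ _ _ ab0);
  apply: filterS recover => k [] *; eassumption.
Unshelve. all: by end_near. Qed.
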